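(* Each of the following families $F_c$ is an FC-family (i.e., every finite union-closed family $F$ with $F \supseteq F_c$ satisfies the Frankl condition): (1) $F_c = \{\{a\}\}$ for any element $a$; (2) $F_c = \{\{a,b\}\}$ for any elements $a \neq b$; (3) any family $F_c$ consisting of $3$ distinct $3$-element sets whose union has at most $5$ elements; (4) any family $F_c$ consisting of $4$ distinct $3$-element sets whose union has at most $6$ elements; (5) any family $F_c$ consisting of $4$ distinct $3$-element sets whose union has at most $7$ elements.
   Context: All sets and families (sets of sets) are finite. A family $F$ is union closed if $A \cup B \in F$ for all $A, B \in F$. A family $F$ satisfies the Frankl condition (is Frankl's) if there exists $a \in \bigcup F$ with $2\cdot|\{A \in F : a \in A\}| \ge |F|$. A family $F_c$ is an FC-family if every union-closed family $F \supseteq F_c$ satisfies the Frankl condition. *)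

(* Defs.v *)
(* Families of sets are {set {set T}} over an arbitrary finType T
   (any finite family of finite sets lives over a finite ground set). *)
From mathcomp Require Import all_boot.
Set Implicit Arguments. Unset Strict Implicit. Unset Printing Implicit Defensive.

Definition union_closed (T : finType) (F : {set {set T}}) : Prop :=
  forall A B, A \in F -> B \in F -> A :|: B \in F.

Definition frankl (T : finType) (F : {set {set T}}) : Prop :=
  exists a : T, a \in cover F /\ #|F| <= 2 * #|[set A in F | a \in A]|.

Definition FC_family (T : finType) (Fc : {set {set T}}) : Prop :=
  forall F : {set {set T}}, union_closed F -> Fc \subset F -> frankl F.

(* Main.v *)
Require Import Defs.
From mathcomp Require Import all_boot.

(** Give the points of [X := cover Fc] weights [w] and split [F] into the fibres
    [F_K = {A in F | A \ X = K}]. If in every fibre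
    [sum (A in F_K) w(A) >= #|F_K| * w(X) / 2], then some point of [X] lies in
    half of the members of [F]. Let [g] be the indicator function of the traces
    on [X] of a fibre. As these traces are closed under union with one another
    and with members of [Fc],
      [g a + g b <= g (a U b) + g c]
    whenever [c] arises from [a], and also from [b], by adding members of [Fc]:
    if [g a] or [g b] holds then so does [g c], and if both hold then so does
    [g (a U b)]. The weight bound turns out to be a nonnegative integer
    combination of such inequalities and of [g m >= 0]; these combinations, found
    by linear programming, serve as certificates. Up to isomorphism there are 4
    families of three triples on at most 5 points, and 10 families of four
    triples on at most 7 points that contain none of the former. *)

Set Implicit Arguments.
Unset Strict Implicit.
Unset Printing Implicit Defensive.

(** * Bit codes and certificates *)

Definition bor (a b : bitseq) : bitseq := [seq p.1 || p.2 | p <- zip a b].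

Fixpoint bitseqs n : seq bitseq :=
  if n is n'.+1 then map (cons true) (bitseqs n') ++ map (cons false) (bitseqs n')
  else [:: [::]].

(** Whether [c] arises from [a] by adding members of [Q]. It is enough to add all members contained
    in [c] at once, since any selection that leads to [c] consists of such members. *)
Definition reach (Q : seq bitseq) (a c : bitseq) :=
  foldr (fun t m => if bor t c == c then bor m t else m) a Q == c.

(** An entry [(k, a, b, c)] of [L] stands for [k] times the inequality
    [g a + g b <= g (bor a b) + g c]; taking [b = c] gives [g a <= g c]. The last
    conjunct compares the coefficients of [g m] on both sides. *)
Definition check_cert (w : seq nat) (Q : seq bitseq)
    (L : seq (nat * bitseq * bitseq * bitseq)) :=
  [&& has (leq 1) w,
      all (fun '(_, a, b, c) => reach Q a c && reach Q b c) L &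
      all (fun m =>
        sumn w + sumn [seq k * ((bor a b == m) + (c == m)) | '(k, a, b, c) <- L]
        <= 2 * sumn (mask m w)
           + sumn [seq k * ((a == m) + (b == m)) | '(k, a, b, c) <- L])
      (bitseqs (size w))].

(** The points of the cover occupy the slots of a list [e : seq (option T)];
    [None] pads the list to a fixed length, as [T] itself may be too small. *)
Definition in_slot (T : finType) (A : {set T}) (o : option T) :=
  if o is Some x then x \in A else false.

Definition code (T : finType) (e : seq (option T)) (A : {set T}) : bitseq :=
  [seq in_slot A o | o <- e].

Definition ground (T : finType) (e : seq (option T)) : {set T} :=
  [set x | Some x \in e].

Lemma mem_bitseqs n m : (m \in bitseqs n) = (size m == n).
Proof.
have inj_cons b : injective (cons b : bitseq -> bitseq) by move=> ? ? [].
have mem_other b b' (m' : bitseq) s :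
    b != b' -> (b :: m' \in map (cons b') s) = false.
  by move=> neq; apply/mapP => -[? _ [eqb _]]; rewrite eqb eqxx in neq.
elim: n m => [|n IHn] [|b m] //=; rewrite mem_cat.
  by apply/norP; split; apply/mapP => -[].
by case: b; rewrite (mem_map (@inj_cons _)) IHn mem_other ?orbF.
Qed.

Lemma codeU (T : finType) (e : seq (option T)) (A B : {set T}) :
  code e (A :|: B) = bor (code e A) (code e B).
Proof.
rewrite /bor; elim: e => //= -[x|] e ->; rewrite /= ?inE //.
Qed.

Lemma code_inj (T : finType) (e : seq (option T)) (A B : {set T}) :
  A :\: ground e = B :\: ground e -> code e A = code e B -> A = B.
Proof.
move=> eqD /eq_in_map eqC; apply/setP=> x.
have [/eqC //|xNe] := boolP (Some x \in e).
by move/setP/(_ x): eqD; rewrite !inE xNe.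
Qed.

(** * Fibres and the exchange inequality *)

(** The cardinality of this set, 0 or 1, is the value at [m] of the indicator function of the traces
    in the fibre over [K]. *)
Definition fiber (T : finType) (F : {set {set T}}) (K : {set T})
    (e : seq (option T)) (m : bitseq) : {set {set T}} :=
  [set A in F | (A :\: ground e == K) && (code e A == m)].

Lemma card_fiber_le1 (T : finType) (F : {set {set T}}) K e m :
  #|fiber F K e m| <= 1.
Proof.
apply/card_le1_eqP => A B; rewrite !inE.
move=> /and3P[_ /eqP KA /eqP cA] /and3P[_ /eqP KB /eqP cB].
by apply: (@code_inj _ e); congruence.
Qed.

Lemma fiberU (T : finType) (F : {set {set T}}) K e a b :
    union_closed F -> 0 < #|fiber F K e a| -> 0 < #|fiber F K e b| ->
  0 < #|fiber F K e (bor a b)|.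
Proof.
move=> clF /card_gt0P[A] /[!inE] /and3P[FA /eqP KA /eqP cA].
move=> /card_gt0P[B] /[!inE] /and3P[FB /eqP KB /eqP cB].
apply/card_gt0P; exists (A :|: B).
by rewrite !inE clF //= setDUl KA KB setUid codeU cA cB !eqxx.
Qed.

(** Adding a member of [F] that lies inside [ground e] does not change the part outside [ground e],
    so the union stays in the same fibre. Induction on [Q] adds the members one by one. *)
Lemma fiber_reach (T : finType) (F : {set {set T}}) K e Q a c :
    union_closed F ->
    {in Q, forall q, exists2 A, A \in F & A \subset ground e /\ code e A = q} ->
  reach Q a c -> 0 < #|fiber F K e a| -> 0 < #|fiber F K e c|.
Proof.
move=> clF + /eqP <- Fa; elim: Q c => //= t Q IHQ c FQ.
have {}IHQ d : 0 < #|fiber F K e (foldr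
     (fun t m => if bor t d == d then bor m t else m) a Q)|.
  by apply: IHQ => q Qq; apply: FQ; rewrite inE Qq orbT.
case: ifP => // _; move: (IHQ c); set m := foldr _ _ _.
case: (FQ t (mem_head _ _)) => B FB [BX <-].
move=> /card_gt0P[A] /[!inE] /and3P[FA /eqP KA /eqP cA].
apply/card_gt0P; exists (A :|: B); rewrite !inE clF //= codeU cA eqxx andbT.
by move: BX; rewrite setDUl KA -setD_eq0 => /eqP->; rewrite setU0.
Qed.

Lemma fiber_exchange (T : finType) (F : {set {set T}}) K e Q a b c :
    union_closed F ->
    {in Q, forall q, exists2 A, A \in F & A \subset ground e /\ code e A = q} ->
    reach Q a c -> reach Q b c ->
  #|fiber F K e a| + #|fiber F K e b|
    <= #|fiber F K e (bor a b)| + #|fiber F K e c|.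
Proof.
move=> clF FQ ac bc.
have ca := fiber_reach clF FQ ac (K := K).
have cb := fiber_reach clF FQ bc (K := K).
have cab := fiberU clF (a := a) (b := b) (K := K) (e := e).
(* Both counts on the left are 0 or 1. If exactly one is 1, [c] pays for it; if both are, [bor a b]
   and [c] pay for one each. *)
move: (card_fiber_le1 F K e a) (card_fiber_le1 F K e b) ca cb cab.
case: #|fiber F K e a| => [|[|//]]; case: #|fiber F K e b| => [|[|//]] // _ _.
- by move=> _ /(_ isT) c_gt0 _; apply: leq_trans c_gt0 (leq_addl _ _).
- by move=> /(_ isT) c_gt0 _ _; apply: leq_trans c_gt0 (leq_addl _ _).
- by move=> /(_ isT) c_gt0 _ /(_ isT isT) ab_gt0; apply: leq_add.
Qed.

(** * From a certificate to the Frankl condition *)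

(** Turns coefficients summed over the members of a fibre into values of its indicator function. *)
Lemma sum_code_eq (T : finType) (F : {set {set T}}) K e m :
  \sum_(A in F | A :\: ground e == K) (m == code e A) = #|fiber F K e m|.
Proof.
rewrite -sum1_card [RHS](eq_bigl (fun A : {set T} =>
  (A \in F) && (A :\: ground e == K) && (m == code e A))); last first.
  by move=> A; rewrite inE andbA [code e A == m]eq_sym.
by rewrite [RHS]big_mkcondr; apply: eq_bigr => A _; case: (m == _).
Qed.

(** The coefficient comparison of [check_cert] at [m = code e A], summed over the members [A] of the
    fibre, bounds the left side plus [up] by the right side plus [dn]. The exchange inequalities
    give [dn <= up], and [up] cancels. *)
Lemma weight_ge_fiber (T : finType) (F : {set {set T}}) K e w Q L :
    union_closed F -> size e = size w ->
    {in Q, forall q, exists2 A, A \in F & A \subset ground e /\ code e A = q} ->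
    check_cert w Q L ->
  \sum_(A in F | A :\: ground e == K) sumn w
    <= \sum_(A in F | A :\: ground e == K) 2 * sumn (mask (code e A) w).
Proof.
move=> clF se FQ /and3P[_ Lok /allP chk].
pose P A := (A \in F) && (A :\: ground e == K).
pose up := \sum_(x <- L) let: (k, a, b, c) := x in
   k * (#|fiber F K e (bor a b)| + #|fiber F K e c|).
pose dn := \sum_(x <- L) let: (k, a, b, c) := x in
   k * (#|fiber F K e a| + #|fiber F K e b|).
have dn_up : dn <= up.
  rewrite /dn /up !big_seq; apply: leq_sum => -[[[k a] b] c] Lx.
  have /andP[ac bc] := allP Lok _ Lx.
  by rewrite leq_mul2l (fiber_exchange _ clF FQ) ?orbT.
rewrite -(leq_add2r up).
apply: (@leq_trans (\sum_(A in F | A :\: ground e == K)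
    2 * sumn (mask (code e A) w) + dn));
  last by rewrite leq_add2l.
have -> : up = \sum_(A | P A) sumn
    [seq k * ((bor a b == code e A) + (c == code e A)) | '(k, a, b, c) <- L].
  under eq_bigr do rewrite sumnE big_map.
  rewrite exchange_big; apply: eq_bigr => -[[[k a] b] c] _ /=.
  by rewrite -big_distrr /= big_split /= !sum_code_eq.
have -> : dn = \sum_(A | P A) sumn
    [seq k * ((a == code e A) + (b == code e A)) | '(k, a, b, c) <- L].
  under eq_bigr do rewrite sumnE big_map.
  rewrite exchange_big; apply: eq_bigr => -[[[k a] b] c] _ /=.
  by rewrite -big_distrr /= big_split /= !sum_code_eq.
rewrite -!big_split /=; apply: leq_sum => A _.
by apply: chk; rewrite mem_bitseqs size_map se.
Qed.

(** Averaging: if every point were in fewer than half of the members, the weighted sum of the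
    degrees would fall strictly below the bound obtained by adding up the fibres. *)
Lemma check_cert_frankl (T : finType) (F : {set {set T}}) e w Q L :
    union_closed F -> F != set0 -> size e = size w ->
    {in Q, forall q, exists2 A, A \in F & A \subset ground e /\ code e A = q} ->
  check_cert w Q L -> frankl F.
Proof.
move=> clF F0 se FQ chk; have F_gt0 : 0 < #|F| by rewrite card_gt0.
have [/existsP[a /andP[]]|noF] :=
  boolP [exists a, (a \in cover F) && (#|F| <= 2 * #|[set A in F | a \in A]|)].
  by exists a.
pose deg o := \sum_(A in F) in_slot A o.
have deg_lt o : 2 * deg o < #|F|.
  (* A padding slot has degree 0, which is less than half because [F] is nonempty. *)
  rewrite /deg; case: o => [x|] /=; last by rewrite big1 ?muln0.
  have -> : \sum_(A in F) (x \in A) = #|[set A in F | x \in A]|.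
    by rewrite -sum1dep_card [RHS]big_mkcondr.
  rewrite ltnNge; apply: contra noF => leF; apply/existsP; exists x.
  rewrite leF andbT; apply/bigcupP.
  (* A point in at least half of the members of a nonempty family is in some member, hence in the
     cover. *)
  have /card_gt0P[A] : 0 < #|[set A in F | x \in A]|.
    by rewrite lt0n; apply: contraTneq leF => ->; rewrite muln0 -ltnNge.
  by rewrite inE => /andP[FA Ax]; exists A.
have {chk} : \sum_(A in F) sumn w <= \sum_(A in F) 2 * sumn (mask (code e A) w)
    /\ has (leq 1) w.
  split; last by case/and3P: chk.
  rewrite (partition_big (fun A : {set T} => A :\: ground e) xpredT) //.
  rewrite [leqRHS](partition_big (fun A : {set T} => A :\: ground e) xpredT) //.
  by apply: leq_sum => K _; apply: weight_ge_fiber clF se FQ chk.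
have maskE A :
    sumn (mask (code e A) w) = \sum_(p <- zip e w) in_slot A p.1 * p.2.
  elim: e w se {FQ deg_lt} => [|o e IHe] [|n w] //=; first by rewrite big_nil.
  by move=> [se]; rewrite big_cons -IHe //; case: (in_slot A o); rewrite /= ?mul1n.
have sumwE : sumn w = \sum_(p <- zip e w) p.2.
  by rewrite -(big_map snd xpredT id) -/(unzip2 _) unzip2_zip ?se // sumnE.
have -> : \sum_(A in F) sumn w = \sum_(p <- zip e w) #|F| * p.2.
  by rewrite sum_nat_const sumwE big_distrr.
(* Double counting: the weights of the members become the weighted degrees of the slots. *)
have -> : \sum_(A in F) 2 * sumn (mask (code e A) w) =
    \sum_(p <- zip e w) 2 * deg p.1 * p.2.
  under eq_bigr do rewrite maskE big_distrr /=.
  rewrite exchange_big /=; apply: eq_bigr => p _.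
  by rewrite -mulnA big_distrl /= big_distrr /=.
(* One slot [i] of positive weight makes the comparison strict; the other slots compare weakly. *)
case=> + /(has_nthP 0)[i iw w_gt0]; rewrite leqNgt => /negP[].
rewrite (big_nth (None, 0)) [ltnRHS](big_nth (None, 0)) !big_mkord.
have iz : i < size (zip e w) by rewrite size_zip se minnn.
rewrite (bigD1 (Ordinal iz)) //= [ltnRHS](bigD1 (Ordinal iz)) //= -addSn leq_add //.
  by rewrite nth_zip //= ltn_pmul2r.
by apply: leq_sum => j _; rewrite leq_mul2r (ltnW (deg_lt _)) orbT.
Qed.

(** * Classification up to relabelling of the points *)

(** The columns of the incidence matrix with rows [Q]. Relabelling the points permutes the columns
    and keeps the order of the rows, so [perm_eq] of columns decides equality up to relabelling
    without a search through permutations of the points. *)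
Definition cols n (Q : seq bitseq) : seq bitseq :=
  [seq [seq nth false q j | q <- Q] | j <- iota 0 n].

(** Up to a permutation of the [n] points, adding an [r]-set to a family in [R]
    gives a family from which some selection [s] in [sels] of rows is in [R']. *)
Definition extends n r (sels : seq (seq nat)) (R R' : seq (seq bitseq)) :=
  all (fun Q => all (fun t => (t \in Q) ||
      has (fun s => all (geq (size Q)) s &&
        has (fun Q' => (size Q' == size s) &&
          perm_eq (cols n Q') (cols n [seq nth [::] (t :: Q) i | i <- s]))
        R') sels)
    [seq t <- bitseqs n | count id t == r]) R.

Lemma perm_cols n Q Q' :
    {in Q, forall q, size q = n} -> {in Q', forall q, size q = n} ->
    size Q' = size Q -> perm_eq (cols n Q') (cols n Q) ->
  exists2 p, perm_eq p (iota 0 n) &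
    Q' = [seq [seq nth false q i | i <- p] | q <- Q].
Proof.
move=> szQ szQ' eq_sz /(perm_iotaP [::])[p]; rewrite size_map size_iota.
move=> p_iota colsE.
exists p => //; apply: (@eq_from_nth _ [::]); rewrite ?size_map // => i ltiQ'.
have ltiQ : i < size Q by rewrite -eq_sz.
have szp : size p = n by rewrite (perm_size p_iota) size_iota.
rewrite (nth_map [::]) //; apply: (@eq_from_nth _ false).
  by rewrite szQ' ?mem_nth // size_map szp.
rewrite szQ' ?mem_nth // => j ltjn; rewrite (nth_map 0) ?szp //.
have ltpn : nth 0 p j < n.
  have : nth 0 p j \in iota 0 n by rewrite -(perm_mem p_iota) mem_nth ?szp.
  by rewrite mem_iota.
move/(congr1 (fun M => nth false (nth [::] M j) i)): colsE.
rewrite (nth_map 0) ?size_iota // [in RHS](nth_map 0) ?szp //.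
by rewrite (nth_map 0) ?size_iota // !nth_iota // !(nth_map [::]).
Qed.

Definition slots (T : finType) n (X : {set T}) : seq (option T) :=
  map Some (enum X) ++ nseq (n - #|X|) None.

(** [Fc] contains a copy of [Q]: its members listed in [s] have the codes [Q] under the labelling
    [e] of the points, a rearrangement of the reference labelling [slots]. *)
Definition placed (T : finType) n (Fc : {set {set T}}) (Q : seq bitseq) :=
  exists e s, [/\ perm_eq e (slots n (cover Fc)), {subset s <= Fc} &
    Q = map (code e) s].

Lemma ground_slots (T : finType) n (X : {set T}) e :
  perm_eq e (slots n X) -> ground e = X.
Proof.
move=> /perm_mem eqe; apply/setP => x; rewrite inE eqe mem_cat.
by rewrite mem_map ?mem_enum ?mem_nseq ?andbF ?orbF // => ? ? [].
Qed.

Lemma size_slots (T : finType) n (X : {set T}) e :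
  #|X| <= n -> perm_eq e (slots n X) -> size e = n.
Proof.
by move=> leXn /perm_size->; rewrite size_cat size_map size_nseq -cardE subnKC.
Qed.

Lemma count_code (T : finType) n (X A : {set T}) e :
  perm_eq e (slots n X) -> A \subset X -> count id (code e A) = #|A|.
Proof.
move=> /permP eqe sAX; rewrite count_map eqe count_cat count_map.
rewrite [count _ (nseq _ _)]count_nseq mul0n addn0 -size_filter cardE.
apply/perm_size/uniq_perm => [||x].
- exact/filter_uniq/enum_uniq.
- exact: enum_uniq.
by rewrite mem_filter !mem_enum andb_idr // => /(subsetP sAX).
Qed.

Lemma sub_cover (T : finType) (Fc : {set {set T}}) A :
  A \in Fc -> A \subset cover Fc.
Proof. exact: bigcup_sup. Qed.

(** One step of the classification: a member of [Fc] outside the copy of [Q] is added to it, and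
    [extends] supplies the rows to keep and the relabelling that makes them a representative in
    [R']. *)
Lemma placed_extends (T : finType) n r sels R R' (Fc : {set {set T}}) :
    (forall A, A \in Fc -> #|A| = r) -> #|cover Fc| <= n ->
    all (fun Q => size Q < #|Fc|) R -> all (all (fun q => size q == n)) R' ->
    extends n r sels R R' ->
  (exists2 Q, Q \in R & placed n Fc Q) -> exists2 Q, Q \in R' & placed n Fc Q.
Proof.
move=> Fr leXn ltR szR' /allP ext [Q RQ [e [s [eqe sFc QE]]]].
have ge := ground_slots eqe; have sze := size_slots leXn eqe.
(* The list [s] is shorter than [Fc], so it misses a member. *)
have [A FA sA] : exists2 A, A \in Fc & A \notin s.
  have /allP/(_ _ RQ) := ltR; rewrite QE size_map => lts.
  have /subsetPn[A] : ~~ (Fc \subset s); last by exists A.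
  apply: contraL lts => sFs; rewrite -leqNgt.
  by apply: leq_trans (subset_leq_card sFs) (card_size s).
have /allP/(_ (code e A)) := ext _ RQ.
rewrite mem_filter (count_code eqe) ?sub_cover // Fr // eqxx.
rewrite mem_bitseqs size_map sze eqxx.
(* Members of [Fc] lie inside [ground e], so their codes determine them and a new member has a new
   code. *)
have /negPf-> : code e A \notin Q.
  rewrite QE; apply: contra sA => /mapP[B sB /code_inj->] //.
  have D0 C : C \in Fc -> C :\: cover Fc = set0.
    by move=> FC; apply/eqP; rewrite setD_eq0 sub_cover.
  by rewrite ge !D0 //; apply: sFc.
move=> /(_ isT) /hasP[sel _ /andP[/allP sel_lt /hasP[Q' RQ' /andP[/eqP szQ']]]].
pose s' := [seq nth set0 (A :: s) i | i <- sel].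
(* Index 0 is the added member, so indices up to and including [size Q] are valid. *)
have sel_lt' i : i \in sel -> i < size (A :: s).
  by move=> /sel_lt /=; rewrite QE size_map.
have -> : [seq nth [::] (code e A :: Q) i | i <- sel] = map (code e) s'.
  rewrite -map_comp; apply/eq_in_map => i /sel_lt' lti /=.
  by rewrite QE -map_cons (nth_map set0).
move=> /perm_cols[q /mapP[B _ ->]|q||p p_iota Q'E].
- by rewrite size_map.
- by move/(allP (allP szR' _ RQ')) => /eqP.
- by rewrite szQ' !size_map.
(* The new labelling reads the slots of [e] in the order [p]. *)
exists Q' => //; exists [seq nth None e i | i <- p], s'; split.
- apply: perm_trans eqe.
  by rewrite -{2}(mkseq_nth None e) sze; apply: perm_map.
- move=> B /mapP[i /sel_lt' lti ->].
  by have := mem_nth set0 lti; rewrite inE => /predU1P[->|/sFc].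
rewrite Q'E -map_comp; apply: eq_map => B /=; rewrite /code -map_comp.
apply/eq_in_map => i; rewrite (perm_mem p_iota) mem_iota add0n -sze => lti.
by rewrite /= (nth_map None).
Qed.

Lemma placed_nil (T : finType) n (Fc : {set {set T}}) : placed n Fc [::].
Proof. by exists (slots n (cover Fc)), [::]. Qed.

(** The certificate uses only the members coded by [Q], while the fibres are taken over all of
    [cover Fc]. *)
Lemma placed_frankl (T : finType) n (Fc : {set {set T}}) w Q L :
    Fc != set0 -> #|cover Fc| <= n -> size w = n -> placed n Fc Q ->
  check_cert w Q L -> FC_family Fc.
Proof.
move=> Fc0 leXn szw [e [s [eqe sFc ->]]] chk F clF sF.
apply: (check_cert_frankl (e := e) clF _ _ _ chk).
- by apply: contraNneq Fc0 => F0; rewrite -subset0 -F0.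
- by rewrite szw (size_slots leXn eqe).
move=> q /mapP[A /sFc FA ->]; exists A; first exact: (subsetP sF).
by rewrite (ground_slots eqe) sub_cover.
Qed.

(** Serves to exclude representatives that span more points than [Fc] does. *)
Lemma placed_card_cover (T : finType) n (Fc : {set {set T}}) Q :
    #|cover Fc| <= n -> placed n Fc Q ->
  count id (foldr bor (nseq n false) Q) <= #|cover Fc|.
Proof.
move=> leXn [e [s [eqe sFc ->]]].
have -> : foldr bor (nseq n false) (map (code e) s) = code e (\bigcup_(A <- s) A).
  elim: s {sFc} => [|A s /= ->]; last by rewrite big_cons codeU.
  rewrite big_nil -(size_slots leXn eqe) /=.
  by elim: e {eqe} => //= -[x|] e ->; rewrite //= inE.
have sUX : \bigcup_(A <- s) A \subset cover Fc.
  rewrite big_seq; elim/big_ind: _ => [|A B sA sB|A /sFc /sub_cover //].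
    exact: sub0set.
  by rewrite subUset sA.
by rewrite (count_code eqe sUX) subset_leq_card.
Qed.

(** * The certificates *)

(** Least significant bit first: [7] stands for the set of the points 0, 1, 2 and [11] for that of
    0, 1, 3. *)
Fixpoint bits n k : bitseq :=
  if n is n'.+1 then odd k :: bits n' k./2 else [::].

(** Extends a certificate over the sets below [h = 2 ^ j], where the points
    [j], ..., [6] have weight 0, to all subsets of 7 points. *)
Definition spread (h : nat) (L : seq (nat * nat * nat * nat)) :=
  flatten [seq [seq (k, a + i * h, b + i * h, c + i * h) | '(k, a, b, c) <- L]
          | i <- iota 0 (128 %/ h)].

Definition check n (x : seq nat * seq nat * seq (nat * nat * nat * nat)) :=
  let: (Q, w, L) := x in
  (size w == n) && check_cert w (map (bits n) Q)
    [seq (k, bits n a, bits n b, bits n c) | '(k, a, b, c) <- L].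

(** Each entry holds a family, the weights of the seven points and the multiplied inequalities. The
    first family spans four points and the others five; the remaining points have weight 0. *)
Definition certs3 : seq (seq nat * seq nat * seq (nat * nat * nat * nat)) := [::
([:: 7; 11; 13], [:: 1; 1; 1; 1; 0; 0; 0],
 spread 16 [::
   (2, 0, 11, 11); (2, 0, 13, 13); (2, 1, 7, 7); (2, 2, 8, 11);
   (2, 4, 10, 15); (2, 11, 15, 15)]);
([:: 7; 11; 19], [:: 3; 3; 2; 2; 2; 0; 0],
 spread 32 [::
   (8, 0, 7, 7); (1, 0, 11, 11); (3, 0, 19, 19); (1, 1, 8, 11);
   (1, 1, 12, 15); (1, 1, 16, 19); (3, 1, 20, 23); (2, 2, 8, 11);
   (4, 2, 24, 27); (1, 4, 9, 15); (3, 4, 16, 23); (2, 4, 18, 23);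
   (2, 4, 26, 31); (2, 5, 24, 31); (2, 6, 8, 15); (4, 7, 15, 15);
   (2, 8, 16, 27); (1, 8, 21, 31); (2, 9, 16, 27); (4, 10, 20, 31);
   (3, 12, 17, 31)]);
([:: 7; 11; 21], [:: 4; 3; 3; 2; 2; 0; 0],
 spread 32 [::
   (9, 0, 7, 7); (5, 0, 21, 21); (2, 1, 12, 15); (3, 1, 16, 21);
   (1, 1, 24, 31); (1, 2, 4, 7); (2, 2, 8, 11); (3, 2, 16, 23);
   (1, 2, 20, 23); (1, 2, 23, 23); (2, 4, 9, 15); (2, 4, 10, 15);
   (1, 4, 16, 21); (2, 4, 24, 31); (1, 6, 26, 31); (2, 6, 28, 31);
   (4, 7, 15, 15); (3, 8, 16, 31); (5, 8, 29, 29); (2, 10, 11, 11);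
   (2, 10, 20, 31); (2, 12, 24, 29); (4, 17, 18, 27); (1, 17, 24, 27);
   (1, 18, 20, 23); (2, 18, 24, 27); (1, 20, 31, 31); (4, 21, 23, 23);
   (1, 21, 31, 31); (1, 24, 27, 27); (1, 26, 28, 31); (1, 28, 29, 29)]);
([:: 7; 11; 28], [:: 2; 2; 2; 2; 1; 0; 0],
 spread 32 [::
   (8, 0, 7, 7); (1, 0, 28, 28); (3, 1, 8, 11); (2, 1, 29, 29); (1, 2, 4, 7);
   (1, 2, 16, 31); (3, 2, 30, 30); (1, 3, 16, 31); (3, 4, 9, 15);
   (1, 4, 10, 15); (1, 5, 8, 15); (1, 6, 8, 15); (1, 6, 12, 15);
   (6, 7, 31, 31); (1, 9, 17, 29); (1, 13, 29, 29); (2, 16, 23, 23);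
   (2, 16, 27, 27); (1, 16, 28, 28); (2, 17, 20, 23); (1, 18, 20, 23);
   (3, 18, 24, 27); (1, 21, 29, 29); (2, 26, 30, 30); (1, 28, 31, 31)])].

(** The first two families span six points, so their certificates are spread over the seventh; the
    other eight span all seven. *)
Definition certs4 : seq (seq nat * seq nat * seq (nat * nat * nat * nat)) := [::
([:: 7; 11; 52; 56], [:: 1; 1; 1; 1; 1; 1; 0],
 spread 64 [::
   (6, 0, 52, 52); (2, 1, 4, 7); (2, 1, 8, 11); (1, 2, 8, 11);
   (2, 2, 54, 54); (1, 2, 58, 58); (1, 3, 48, 55); (1, 3, 48, 59);
   (2, 4, 16, 52); (2, 5, 9, 61); (1, 5, 33, 53); (1, 5, 53, 53);
   (2, 6, 42, 62); (2, 7, 15, 15); (1, 8, 11, 11); (2, 9, 57, 57);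
   (1, 10, 18, 58); (2, 10, 34, 58); (4, 11, 59, 59); (1, 12, 16, 60);
   (1, 12, 20, 60); (1, 13, 33, 61); (1, 13, 37, 61); (1, 16, 27, 27);
   (2, 17, 20, 23); (1, 18, 28, 31); (1, 20, 26, 31); (1, 21, 24, 31);
   (1, 21, 28, 31); (1, 24, 27, 27); (2, 32, 39, 39); (2, 32, 43, 43);
   (2, 36, 40, 47); (2, 44, 47, 47); (8, 52, 55, 55); (5, 55, 63, 63);
   (2, 58, 62, 62); (1, 59, 63, 63)]);
([:: 7; 25; 42; 52], [:: 1; 1; 1; 1; 1; 1; 0],
 spread 64 [::
   (6, 0, 52, 52); (1, 1, 4, 7); (1, 1, 16, 25); (2, 1, 32, 55);
   (1, 2, 8, 42); (2, 2, 27, 27); (1, 2, 32, 42); (1, 3, 10, 27);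
   (1, 3, 48, 55); (2, 4, 16, 31); (1, 4, 52, 52); (1, 5, 9, 61);
   (1, 5, 33, 47); (1, 5, 33, 53); (2, 6, 34, 54); (1, 7, 47, 47);
   (1, 8, 16, 25); (1, 8, 32, 61); (1, 8, 60, 60); (1, 9, 33, 43);
   (1, 10, 12, 15); (1, 10, 15, 15); (1, 11, 63, 63); (1, 12, 36, 46);
   (1, 13, 33, 47); (1, 14, 15, 15); (1, 15, 31, 31); (2, 17, 20, 23);
   (1, 17, 34, 59); (2, 18, 24, 58); (2, 20, 26, 31); (2, 21, 29, 29);
   (1, 24, 40, 60); (2, 25, 61, 61); (1, 27, 59, 59); (1, 31, 63, 63);
   (1, 36, 46, 46); (1, 37, 44, 47); (1, 37, 53, 53); (2, 38, 39, 39);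
   (1, 40, 48, 57); (1, 40, 57, 57); (1, 41, 43, 43); (2, 42, 59, 59);
   (2, 52, 55, 55); (5, 52, 62, 62); (1, 55, 63, 63); (2, 56, 63, 63);
   (1, 62, 63, 63)]);
([:: 7; 11; 49; 81], [:: 3; 2; 1; 1; 2; 1; 1],
 [::
   (6, 0, 11, 11); (4, 0, 49, 49); (1, 0, 81, 81); (2, 1, 2, 7);
   (1, 1, 4, 7); (1, 1, 16, 49); (1, 1, 24, 91); (1, 2, 51, 51);
   (3, 2, 64, 91); (1, 2, 80, 87); (1, 3, 18, 51); (2, 3, 34, 51);
   (1, 4, 8, 15); (1, 4, 48, 55); (1, 4, 53, 53); (5, 4, 64, 87);
   (2, 5, 20, 53); (2, 5, 68, 85); (3, 6, 48, 55); (2, 6, 68, 87);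
   (2, 7, 15, 15); (1, 8, 20, 63); (1, 8, 21, 63); (1, 8, 64, 91);
   (1, 8, 69, 95); (1, 8, 80, 91); (3, 8, 117, 127); (2, 9, 24, 57);
   (1, 9, 72, 89); (1, 10, 32, 59); (1, 10, 56, 59); (3, 10, 76, 95);
   (5, 11, 59, 59); (1, 12, 41, 63); (3, 12, 61, 61); (4, 12, 93, 93);
   (1, 13, 76, 93); (1, 14, 20, 63); (1, 14, 28, 95); (1, 14, 92, 95);
   (5, 16, 23, 23); (1, 16, 27, 27); (2, 17, 18, 27); (1, 20, 25, 31);
   (1, 22, 28, 31); (2, 24, 27, 27); (1, 25, 28, 31); (1, 26, 28, 31);
   (3, 30, 31, 31); (3, 32, 39, 39); (3, 32, 43, 43); (2, 32, 75, 123);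
   (1, 33, 34, 39); (1, 33, 96, 113); (1, 33, 98, 123); (2, 34, 66, 115);
   (1, 35, 51, 51); (1, 35, 98, 115); (1, 36, 40, 47); (4, 36, 68, 117);
   (2, 36, 84, 117); (1, 37, 40, 47); (2, 38, 40, 47); (1, 38, 48, 55);
   (1, 39, 47, 47); (1, 40, 57, 57); (1, 40, 73, 121); (1, 40, 77, 127);
   (1, 42, 72, 123); (1, 42, 80, 123); (1, 42, 104, 123); (1, 42, 116, 127);
   (2, 44, 52, 63); (3, 44, 54, 63); (1, 44, 77, 125); (1, 45, 108, 125);
   (1, 46, 47, 47); (2, 46, 112, 127); (1, 47, 79, 127); (2, 49, 55, 55);
   (2, 49, 113, 113); (1, 50, 66, 115); (1, 52, 70, 119); (1, 52, 100, 117);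
   (1, 56, 100, 127); (1, 56, 104, 121); (2, 60, 61, 61); (1, 60, 76, 125);
   (1, 65, 66, 75); (2, 65, 68, 71); (4, 66, 83, 83); (1, 68, 73, 79);
   (1, 68, 74, 79); (1, 69, 71, 71); (1, 69, 85, 85); (2, 69, 100, 117);
   (1, 70, 72, 79); (1, 70, 80, 87); (2, 70, 96, 119); (4, 72, 75, 75);
   (1, 72, 89, 89); (2, 74, 88, 91); (3, 78, 79, 79); (1, 78, 80, 95);
   (1, 78, 84, 95); (1, 78, 95, 95); (1, 82, 83, 83); (1, 82, 98, 115);
   (2, 87, 119, 119); (1, 88, 89, 89); (1, 88, 104, 121); (1, 90, 112, 123);
   (1, 91, 123, 123); (3, 96, 103, 103); (1, 96, 107, 107); (2, 97, 98, 107);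
   (1, 99, 115, 115); (2, 100, 103, 103); (2, 100, 104, 111);
   (1, 100, 111, 111); (1, 101, 108, 111); (3, 102, 116, 119);
   (2, 106, 108, 111); (1, 106, 120, 123); (1, 108, 118, 127);
   (1, 109, 125, 125); (1, 110, 124, 127); (1, 114, 115, 115);
   (1, 117, 119, 119); (2, 120, 121, 121)]);
([:: 7; 11; 49; 82], [:: 2; 2; 1; 1; 2; 1; 1],
 [::
   (10, 0, 11, 11); (1, 1, 64, 91); (2, 1, 64, 115); (3, 1, 83, 83);
   (2, 2, 16, 55); (3, 2, 32, 115); (1, 2, 33, 59); (1, 3, 18, 51);
   (1, 3, 66, 115); (1, 4, 16, 87); (2, 4, 32, 55); (1, 4, 53, 53);
   (3, 4, 65, 87); (1, 4, 81, 87); (1, 5, 36, 53); (1, 5, 68, 87);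
   (1, 5, 72, 95); (1, 5, 88, 95); (1, 6, 48, 55); (3, 6, 68, 86);
   (2, 8, 16, 59); (1, 8, 57, 57); (1, 8, 69, 95); (1, 8, 81, 91);
   (2, 8, 96, 123); (1, 8, 118, 127); (2, 9, 24, 57); (1, 9, 81, 91);
   (1, 9, 85, 95); (2, 10, 24, 90); (1, 10, 40, 59); (1, 10, 59, 59);
   (6, 11, 15, 15); (4, 11, 91, 91); (1, 12, 50, 63); (2, 12, 54, 63);
   (1, 12, 58, 63); (1, 12, 73, 95); (1, 12, 88, 95); (1, 13, 28, 61);
   (1, 13, 80, 95); (2, 14, 76, 94); (4, 15, 63, 63); (1, 16, 23, 23);
   (1, 17, 18, 27); (1, 17, 24, 27); (1, 18, 20, 23); (1, 18, 28, 31);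
   (1, 20, 23, 23); (1, 20, 24, 31); (2, 20, 26, 31); (1, 22, 23, 23);
   (2, 25, 27, 27); (1, 25, 28, 31); (1, 30, 31, 31); (1, 32, 71, 119);
   (1, 32, 74, 123); (1, 32, 78, 127); (1, 33, 36, 39); (2, 33, 70, 119);
   (1, 34, 36, 39); (1, 34, 40, 43); (1, 34, 48, 59); (2, 34, 51, 51);
   (2, 34, 96, 114); (1, 35, 51, 51); (2, 36, 64, 119); (3, 36, 118, 118);
   (3, 37, 44, 47); (1, 37, 113, 119); (1, 38, 48, 55); (2, 38, 52, 118);
   (1, 40, 48, 59); (2, 40, 112, 123); (1, 40, 122, 122); (1, 41, 43, 43);
   (1, 41, 64, 123); (1, 42, 44, 47); (3, 42, 56, 122); (3, 45, 61, 61);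
   (1, 46, 108, 126); (1, 57, 59, 59); (2, 59, 123, 123); (2, 64, 71, 71);
   (1, 65, 68, 71); (3, 65, 80, 113); (2, 66, 72, 75); (1, 66, 100, 119);
   (1, 67, 83, 83); (1, 68, 121, 127); (1, 69, 71, 71); (1, 69, 76, 79);
   (2, 69, 84, 117); (1, 69, 96, 119); (1, 69, 117, 117); (3, 70, 74, 79);
   (1, 71, 87, 87); (3, 72, 121, 121); (1, 73, 104, 121); (1, 76, 106, 127);
   (1, 77, 92, 125); (3, 77, 108, 125); (4, 78, 94, 94); (1, 86, 106, 127);
   (1, 87, 95, 95); (1, 91, 123, 123); (1, 94, 100, 127); (1, 94, 102, 127);
   (1, 96, 103, 103); (2, 97, 98, 107); (1, 98, 104, 107); (1, 98, 107, 107);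
   (4, 100, 104, 111); (1, 101, 105, 111); (1, 105, 121, 121);
   (2, 108, 120, 127); (1, 109, 111, 111); (1, 109, 125, 125);
   (1, 110, 126, 126); (1, 123, 127, 127)]);
([:: 7; 11; 49; 84], [:: 2; 1; 2; 1; 2; 1; 1],
 [::
   (5, 0, 11, 11); (5, 0, 49, 49); (6, 1, 85, 85); (3, 2, 16, 87);
   (1, 2, 32, 55); (2, 2, 48, 55); (1, 2, 51, 51); (1, 2, 86, 86);
   (1, 3, 16, 87); (3, 3, 66, 87); (1, 4, 25, 95); (1, 4, 32, 55);
   (4, 4, 53, 53); (2, 5, 8, 15); (1, 6, 18, 86); (2, 6, 32, 55);
   (1, 6, 34, 55); (1, 8, 33, 59); (4, 8, 85, 95); (1, 8, 92, 92);
   (4, 9, 24, 57); (2, 10, 32, 59); (2, 10, 54, 63); (2, 10, 94, 94);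
   (7, 11, 15, 15); (1, 12, 25, 125); (3, 12, 61, 61); (2, 13, 25, 93);
   (1, 14, 26, 94); (1, 14, 48, 63); (7, 15, 63, 63); (2, 16, 23, 23);
   (2, 17, 20, 23); (6, 18, 27, 27); (1, 19, 23, 23); (1, 22, 26, 31);
   (1, 23, 31, 31); (4, 27, 31, 31); (2, 32, 43, 43); (1, 33, 36, 39);
   (1, 33, 68, 117); (1, 33, 76, 127); (5, 34, 39, 39); (1, 34, 118, 118);
   (1, 35, 39, 39); (1, 35, 51, 51); (1, 36, 40, 47); (3, 36, 57, 63);
   (1, 37, 40, 47); (4, 38, 50, 118); (1, 38, 58, 63); (5, 39, 64, 119);
   (1, 40, 57, 57); (1, 40, 72, 125); (2, 40, 124, 124); (1, 41, 44, 125);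
   (1, 41, 72, 125); (1, 41, 108, 125); (1, 42, 48, 59); (1, 42, 96, 127);
   (1, 42, 112, 127); (3, 42, 126, 126); (2, 43, 47, 47); (2, 44, 56, 124);
   (5, 49, 117, 117); (1, 55, 119, 119); (6, 63, 127, 127); (2, 64, 71, 71);
   (1, 64, 113, 113); (1, 65, 76, 79); (1, 65, 80, 87); (2, 65, 85, 85);
   (3, 66, 80, 123); (1, 67, 82, 87); (4, 67, 82, 115); (3, 68, 72, 79);
   (2, 70, 98, 119); (1, 72, 92, 92); (1, 73, 76, 125); (1, 73, 88, 121);
   (1, 74, 94, 94); (2, 74, 98, 123); (1, 74, 118, 127); (1, 76, 104, 125);
   (1, 76, 105, 125); (1, 81, 88, 91); (3, 83, 91, 91); (3, 87, 95, 95);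
   (2, 96, 107, 107); (1, 96, 113, 113); (2, 96, 116, 116);
   (2, 97, 100, 103); (1, 101, 104, 111); (2, 102, 106, 111);
   (3, 103, 111, 111); (3, 104, 121, 121); (1, 106, 112, 123);
   (2, 106, 126, 126)]);
([:: 7; 11; 49; 112], [:: 4; 3; 2; 2; 3; 3; 2],
 [::
   (7, 0, 7, 7); (12, 0, 11, 11); (1, 1, 2, 7); (3, 1, 2, 11); (1, 1, 8, 11);
   (2, 1, 12, 15); (2, 1, 16, 49); (1, 1, 80, 113); (1, 1, 98, 119);
   (1, 2, 32, 59); (3, 2, 48, 59); (1, 2, 51, 51); (3, 2, 52, 55);
   (1, 2, 64, 119); (6, 3, 34, 51); (3, 3, 66, 115); (15, 4, 53, 53);
   (1, 5, 36, 53); (1, 5, 68, 117); (4, 5, 84, 117); (1, 5, 96, 119);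
   (3, 6, 56, 63); (6, 6, 118, 118); (1, 7, 15, 15); (8, 7, 55, 55);
   (1, 8, 32, 59); (6, 8, 53, 63); (1, 8, 57, 57); (1, 8, 64, 123);
   (5, 8, 117, 127); (5, 9, 24, 57); (2, 9, 88, 121); (1, 9, 100, 127);
   (3, 10, 48, 59); (6, 10, 122, 122); (1, 11, 15, 15); (3, 11, 59, 59);
   (13, 11, 123, 123); (1, 12, 48, 63); (4, 12, 50, 63); (3, 12, 80, 127);
   (1, 12, 86, 127); (3, 13, 44, 61); (2, 13, 108, 125); (1, 14, 32, 63);
   (4, 14, 126, 126); (1, 15, 127, 127); (10, 16, 23, 23); (1, 16, 71, 119);
   (4, 17, 18, 27); (1, 17, 20, 23); (1, 17, 24, 27); (1, 17, 64, 113);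
   (3, 18, 66, 114); (3, 19, 66, 115); (7, 20, 25, 31); (1, 20, 75, 127);
   (1, 21, 68, 117); (1, 21, 69, 117); (1, 22, 24, 31); (2, 22, 70, 118);
   (6, 23, 64, 119); (1, 24, 72, 120); (1, 24, 73, 121); (3, 26, 74, 122);
   (5, 28, 76, 124); (1, 29, 31, 31); (3, 29, 77, 125); (6, 32, 39, 39);
   (3, 32, 65, 113); (1, 32, 70, 119); (5, 33, 40, 43); (1, 34, 40, 43);
   (1, 34, 64, 123); (1, 35, 66, 115); (4, 35, 67, 115); (3, 36, 41, 47);
   (5, 36, 68, 116); (2, 37, 69, 117); (1, 38, 40, 47); (2, 38, 42, 47);
   (1, 39, 75, 127); (3, 40, 72, 120); (1, 41, 72, 121); (2, 41, 73, 121);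
   (1, 42, 44, 47); (1, 42, 74, 122); (1, 43, 47, 47); (1, 44, 47, 47);
   (1, 45, 72, 127); (2, 45, 76, 125); (4, 46, 78, 126); (1, 49, 55, 55);
   (5, 53, 117, 117); (1, 55, 63, 63); (1, 57, 121, 121); (1, 63, 127, 127);
   (5, 64, 75, 75); (3, 65, 68, 71); (1, 65, 71, 71); (1, 68, 74, 79);
   (4, 69, 72, 79); (2, 70, 72, 79); (1, 80, 87, 87); (4, 80, 91, 91);
   (1, 81, 82, 87); (1, 81, 82, 91); (1, 81, 92, 95); (4, 82, 88, 91);
   (1, 84, 90, 95); (3, 85, 92, 95); (5, 90, 92, 95); (2, 94, 95, 95);
   (8, 96, 103, 103); (1, 97, 98, 103); (3, 97, 104, 107); (1, 98, 104, 107);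
   (1, 98, 107, 107); (2, 99, 107, 107); (3, 100, 104, 111);
   (6, 100, 111, 111); (1, 104, 111, 111); (2, 105, 107, 107);
   (1, 105, 108, 111); (1, 106, 108, 111); (3, 112, 119, 119);
   (1, 116, 121, 127); (3, 116, 122, 127); (1, 118, 119, 119);
   (3, 120, 121, 121)]);
([:: 7; 11; 52; 88], [:: 2; 2; 2; 2; 2; 1; 1],
 [::
   (9, 0, 11, 11); (3, 0, 88, 88); (1, 1, 12, 15); (1, 1, 53, 53);
   (3, 1, 60, 63); (3, 1, 116, 127); (2, 2, 4, 7); (1, 2, 12, 15);
   (1, 2, 44, 63); (4, 2, 54, 54); (1, 3, 32, 55); (2, 3, 48, 55);
   (1, 3, 112, 127); (4, 4, 16, 95); (1, 4, 17, 55); (1, 4, 92, 92);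
   (3, 5, 9, 125); (1, 5, 17, 53); (2, 6, 82, 126); (4, 6, 94, 94);
   (2, 7, 55, 55); (1, 8, 32, 124); (7, 8, 60, 60); (1, 9, 17, 89);
   (2, 10, 34, 126); (2, 10, 38, 126); (9, 11, 15, 15); (2, 12, 68, 92);
   (2, 13, 21, 93); (1, 13, 25, 61); (1, 13, 41, 61); (1, 14, 22, 94);
   (2, 15, 63, 63); (5, 15, 95, 95); (4, 16, 27, 27); (1, 17, 28, 31);
   (4, 18, 20, 23); (4, 20, 24, 31); (3, 22, 28, 31); (8, 32, 39, 39);
   (2, 33, 40, 43); (4, 33, 121, 121); (1, 34, 40, 43); (1, 34, 60, 63);
   (2, 34, 96, 123); (3, 35, 112, 123); (2, 36, 40, 47); (2, 36, 41, 47);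
   (1, 36, 42, 47); (1, 36, 64, 124); (1, 37, 53, 53); (1, 37, 97, 125);
   (4, 39, 64, 127); (2, 39, 72, 127); (2, 40, 97, 123); (1, 41, 77, 125);
   (1, 42, 44, 47); (2, 42, 50, 122); (1, 42, 62, 62); (1, 43, 123, 123);
   (2, 44, 54, 63); (1, 45, 65, 125); (3, 46, 62, 62); (4, 48, 59, 59);
   (2, 49, 56, 59); (2, 52, 124, 124); (1, 53, 60, 63); (1, 62, 126, 126);
   (1, 64, 75, 75); (1, 64, 88, 88); (3, 64, 116, 116); (1, 65, 68, 71);
   (3, 65, 76, 79); (1, 65, 96, 119); (1, 66, 68, 71); (1, 66, 72, 75);
   (1, 66, 76, 79); (1, 66, 96, 119); (2, 66, 100, 119); (2, 67, 80, 119);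
   (2, 68, 97, 119); (3, 69, 93, 93); (2, 70, 72, 79); (1, 70, 94, 94);
   (1, 72, 98, 127); (1, 73, 89, 89); (1, 73, 92, 95); (3, 74, 90, 90);
   (1, 78, 98, 126); (4, 80, 87, 87); (2, 81, 84, 87); (6, 88, 91, 91);
   (1, 90, 96, 127); (3, 96, 107, 107); (1, 98, 104, 107); (4, 98, 118, 118);
   (3, 100, 104, 111); (2, 101, 105, 125); (1, 101, 117, 117);
   (2, 102, 108, 111); (1, 106, 108, 111); (1, 106, 122, 122)]);
([:: 7; 11; 52; 112], [:: 3; 3; 4; 2; 3; 3; 2],
 [::
   (17, 0, 7, 7); (3, 0, 52, 52); (3, 1, 8, 11); (1, 1, 12, 15);
   (10, 1, 53, 53); (13, 2, 54, 54); (1, 2, 114, 114); (4, 3, 48, 123);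
   (4, 3, 115, 115); (2, 4, 8, 15); (2, 4, 10, 15); (1, 4, 26, 63);
   (1, 4, 32, 52); (4, 4, 41, 63); (1, 4, 96, 116); (1, 4, 98, 119);
   (4, 5, 81, 117); (2, 5, 97, 117); (2, 6, 8, 15); (4, 6, 66, 118);
   (12, 7, 55, 55); (5, 7, 119, 119); (1, 8, 53, 63); (6, 8, 54, 63);
   (1, 8, 60, 60); (1, 8, 117, 127); (10, 9, 61, 61); (3, 9, 121, 121);
   (1, 10, 62, 62); (7, 10, 122, 122); (7, 11, 123, 123); (5, 12, 24, 60);
   (4, 12, 72, 124); (3, 13, 105, 125); (2, 14, 26, 62); (1, 14, 42, 62);
   (3, 14, 90, 126); (3, 15, 127, 127); (14, 16, 23, 23); (8, 17, 28, 31);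
   (2, 18, 24, 27); (1, 18, 66, 114); (5, 18, 70, 118); (2, 19, 67, 115);
   (1, 20, 24, 31); (1, 20, 26, 31); (4, 20, 64, 116); (8, 23, 64, 119);
   (2, 24, 76, 124); (2, 25, 73, 121); (2, 25, 77, 125); (2, 26, 74, 122);
   (4, 29, 73, 125); (7, 32, 39, 39); (2, 32, 43, 43); (4, 32, 68, 116);
   (6, 33, 65, 113); (2, 33, 69, 117); (1, 34, 36, 39); (6, 34, 44, 47);
   (1, 34, 70, 118); (2, 35, 67, 115); (4, 36, 40, 47); (2, 36, 64, 116);
   (1, 38, 66, 118); (2, 39, 64, 119); (4, 40, 72, 120); (2, 40, 76, 124);
   (1, 42, 74, 122); (2, 42, 78, 126); (3, 46, 74, 126); (4, 48, 59, 59);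
   (2, 49, 56, 59); (2, 50, 56, 59); (3, 52, 63, 63); (1, 52, 116, 116);
   (3, 53, 120, 127); (1, 54, 60, 63); (1, 60, 118, 127); (1, 61, 125, 125);
   (1, 62, 126, 126); (4, 65, 68, 71); (4, 66, 76, 79); (4, 69, 72, 79);
   (2, 80, 87, 87); (8, 80, 91, 91); (1, 82, 88, 91); (4, 82, 92, 95);
   (4, 84, 88, 95); (2, 84, 89, 95); (1, 86, 88, 95); (3, 91, 95, 95);
   (7, 96, 103, 103); (2, 96, 107, 107); (4, 97, 104, 107);
   (4, 97, 108, 111); (1, 98, 100, 103); (2, 98, 108, 111);
   (6, 100, 104, 111); (1, 100, 105, 111); (1, 100, 106, 111);
   (4, 112, 116, 116); (3, 113, 117, 117); (1, 113, 120, 123);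
   (1, 116, 119, 119); (11, 116, 127, 127); (1, 119, 127, 127);
   (4, 122, 126, 126)]);
([:: 7; 25; 42; 76], [:: 1; 1; 1; 2; 1; 1; 1],
 [::
   (8, 0, 7, 7); (1, 1, 4, 7); (1, 1, 32, 59); (4, 1, 43, 43);
   (1, 2, 64, 110); (4, 2, 78, 78); (1, 2, 81, 95); (1, 3, 10, 79);
   (3, 3, 27, 27); (4, 4, 29, 29); (1, 4, 32, 110); (1, 5, 8, 31);
   (1, 5, 29, 29); (1, 5, 32, 47); (1, 5, 33, 47); (1, 5, 108, 111);
   (1, 6, 10, 78); (1, 6, 18, 31); (2, 6, 46, 46); (7, 7, 47, 47);
   (4, 7, 79, 79); (2, 8, 48, 59); (1, 8, 64, 76); (2, 9, 65, 77);
   (1, 11, 15, 15); (1, 12, 16, 31); (1, 12, 32, 110); (1, 13, 15, 15);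
   (1, 14, 22, 31); (3, 16, 78, 95); (2, 16, 92, 92); (1, 17, 34, 59);
   (3, 17, 68, 93); (2, 18, 24, 58); (1, 18, 94, 94); (1, 19, 38, 63);
   (1, 19, 70, 95); (1, 20, 50, 126); (3, 20, 62, 62); (1, 21, 34, 63);
   (1, 21, 103, 127); (1, 22, 28, 62); (1, 22, 84, 126); (2, 26, 80, 126);
   (1, 27, 65, 95); (2, 29, 32, 63); (1, 29, 63, 63); (2, 33, 36, 125);
   (2, 33, 40, 57); (1, 34, 69, 111); (1, 34, 70, 110); (1, 35, 85, 127);
   (1, 35, 87, 127); (3, 36, 108, 108); (2, 37, 41, 109); (1, 37, 61, 61);
   (2, 37, 100, 125); (1, 37, 109, 109); (1, 38, 69, 111); (2, 43, 64, 111);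
   (1, 44, 52, 61); (5, 47, 63, 63); (2, 48, 124, 124); (2, 49, 101, 125);
   (1, 50, 84, 126); (1, 51, 55, 55); (1, 52, 56, 124); (1, 54, 86, 126);
   (1, 55, 68, 127); (1, 56, 112, 124); (4, 63, 127, 127); (2, 64, 89, 89);
   (1, 65, 74, 123); (1, 66, 72, 106); (2, 66, 80, 123); (2, 66, 91, 91);
   (1, 67, 73, 107); (1, 67, 91, 91); (2, 72, 96, 106); (1, 73, 97, 107);
   (1, 76, 93, 93); (1, 79, 111, 111); (1, 81, 98, 123); (4, 82, 122, 122);
   (1, 83, 98, 123); (2, 85, 87, 87); (2, 96, 121, 121); (1, 97, 104, 121);
   (1, 102, 103, 103); (1, 104, 112, 121); (1, 106, 123, 123)]);
([:: 7; 25; 42; 84], [:: 2; 2; 2; 2; 2; 1; 1],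
 [::
   (4, 0, 42, 42); (8, 0, 84, 84); (1, 1, 2, 7); (2, 1, 8, 47);
   (1, 1, 32, 47); (2, 1, 64, 93); (2, 1, 104, 127); (1, 2, 9, 59);
   (6, 2, 16, 87); (2, 3, 9, 43); (3, 3, 18, 27); (3, 4, 8, 31);
   (2, 4, 16, 31); (1, 4, 29, 29); (1, 4, 32, 47); (1, 4, 72, 93);
   (2, 5, 29, 29); (2, 5, 65, 85); (1, 6, 8, 31); (3, 6, 18, 86);
   (1, 7, 31, 31); (1, 8, 20, 93); (1, 8, 86, 95); (2, 9, 12, 15);
   (1, 9, 70, 95); (1, 10, 24, 126); (3, 10, 64, 95); (1, 11, 27, 27);
   (2, 11, 64, 95); (2, 12, 20, 29); (1, 12, 29, 29); (1, 12, 36, 46);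
   (1, 12, 72, 92); (2, 13, 15, 15); (1, 14, 26, 94); (3, 17, 20, 23);
   (1, 17, 37, 63); (3, 18, 24, 58); (1, 18, 27, 27); (3, 19, 23, 23);
   (3, 21, 29, 29); (3, 22, 28, 62); (2, 23, 33, 63); (3, 26, 74, 94);
   (1, 27, 31, 31); (4, 29, 32, 63); (1, 29, 40, 63); (4, 32, 85, 127);
   (1, 33, 34, 59); (1, 33, 36, 39); (1, 33, 52, 119); (1, 33, 57, 57);
   (1, 33, 96, 125); (1, 34, 36, 39); (2, 34, 49, 119); (1, 34, 81, 127);
   (1, 34, 96, 119); (2, 35, 64, 127); (1, 35, 114, 119); (2, 36, 40, 47);
   (2, 36, 41, 125); (1, 37, 48, 63); (1, 37, 96, 125); (1, 38, 50, 118);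
   (1, 38, 58, 63); (1, 38, 65, 127); (2, 40, 48, 57); (1, 40, 96, 125);
   (6, 42, 59, 59); (1, 44, 46, 46); (4, 44, 56, 124); (3, 48, 55, 55);
   (1, 50, 52, 55); (1, 53, 61, 61); (1, 57, 125, 125); (2, 59, 127, 127);
   (2, 60, 62, 62); (1, 64, 84, 84); (1, 65, 66, 123); (1, 65, 72, 89);
   (1, 65, 107, 107); (2, 65, 108, 111); (2, 66, 68, 71); (1, 66, 72, 106);
   (2, 66, 80, 123); (3, 67, 82, 91); (1, 68, 74, 95); (1, 68, 96, 111);
   (1, 68, 97, 111); (1, 68, 110, 110); (4, 69, 85, 85); (3, 70, 100, 110);
   (1, 72, 80, 89); (1, 72, 92, 92); (3, 73, 76, 79); (1, 74, 76, 79);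
   (1, 74, 82, 91); (1, 77, 79, 79); (2, 80, 96, 123); (1, 80, 98, 123);
   (1, 81, 96, 123); (1, 83, 91, 91); (2, 84, 87, 87); (2, 84, 93, 93);
   (7, 84, 126, 126); (2, 87, 95, 95); (3, 88, 112, 122); (1, 90, 91, 91);
   (1, 90, 94, 94); (2, 97, 98, 103); (1, 97, 104, 121); (1, 97, 112, 119);
   (1, 98, 112, 123); (1, 98, 113, 119); (1, 99, 103, 103);
   (3, 99, 107, 107); (2, 100, 104, 111); (1, 101, 105, 111);
   (1, 101, 105, 125); (3, 102, 118, 118); (1, 105, 125, 125);
   (1, 106, 111, 111); (1, 112, 122, 122); (1, 113, 114, 119);
   (3, 120, 121, 121)])].

(** * Representatives of families of triples on seven points *)

(** Comparing columns is sensitive to the order of the rows, so every order is tried. *)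
Definition orders k := permutations (iota 0 k).

Definition reps1 := map (map (bits 7)) [:: [:: 7]].
(** Two triples that meet in two points, in one point and in none. *)
Definition reps2 := map (map (bits 7)) [:: [:: 7; 11]; [:: 7; 25]; [:: 7; 56]].
Definition reps3small := [seq map (bits 7) x.1.1 | x <- certs3].
(** These families span six or seven points. *)
Definition reps3big := map (map (bits 7))
  [:: [:: 7; 11; 49]; [:: 7; 11; 52]; [:: 7; 11; 112];
    [:: 7; 25; 42]; [:: 7; 25; 97]; [:: 7; 25; 98]].
Definition reps4 := [seq map (bits 7) x.1.1 | x <- certs4].

Lemma placed_certs (T : finType) n certs (Fc : {set {set T}}) Q :
    Fc != set0 -> #|cover Fc| <= n -> all (check n) certs ->
    Q \in [seq map (bits n) x.1.1 | x <- certs] -> placed n Fc Q ->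
  FC_family Fc.
Proof.
move=> Fc0 leXn /allP ok /mapP[[[Q0 w] L] /ok /andP[/eqP szw chk] ->] pl.
exact: placed_frankl Fc0 leXn szw pl chk.
Qed.

(** [lazy] rather than [vm_compute], because the VM evaluates both arguments of
    [&&] and [||]. *)
Lemma check_certs3 : all (check 7) certs3.
Proof. by lazy. Qed.

Lemma check_certs4 : all (check 7) certs4.
Proof. by lazy. Qed.

Lemma extends1 : extends 7 3 (orders 1) [:: [::]] reps1.
Proof. by lazy. Qed.

Lemma extends2 : extends 7 3 (orders 2) reps1 reps2.
Proof. by lazy. Qed.

Lemma extends3 : extends 7 3 (orders 3) reps2 (reps3small ++ reps3big).
Proof. by lazy. Qed.

(** A fourth triple either creates three triples on at most five points, found by selecting three of
    the four rows, or completes a family of [certs4]. *)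
Lemma extends4 :
  extends 7 3 (map (take 3) (orders 4) ++ orders 4) reps3big (reps3small ++ reps4).
Proof. by lazy. Qed.

(** Three members are collected one at a time, starting from the empty list. *)
Lemma placed3 (T : finType) (Fc : {set {set T}}) :
    2 < #|Fc| -> (forall A, A \in Fc -> #|A| = 3) -> #|cover Fc| <= 7 ->
  exists2 Q, Q \in reps3small ++ reps3big & placed 7 Fc Q.
Proof.
move=> Fc_gt2 Fc3 leX7.
apply: (placed_extends Fc3 leX7 _ _ extends3) => [||].
- by rewrite /= !Fc_gt2.
- by lazy.
apply: (placed_extends Fc3 leX7 _ _ extends2) => [||].
- by rewrite /= (ltnW Fc_gt2).
- by lazy.
apply: (placed_extends Fc3 leX7 _ _ extends1) => [||].
- by rewrite /= (ltnW (ltnW Fc_gt2)).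
- by lazy.
by exists [::]; [|apply: placed_nil].
Qed.

(** * The FC-families *)

(** With weights 1 and 1, twice the inequality between the empty trace and the full trace is a
    certificate. For [a = b] the same point fills both slots, which gives the singleton case. *)
Lemma FC_pair (T : finType) (a b : T) : FC_family [set [set a; b]].
Proof.
move=> F clF; rewrite sub1set => Fab.
apply: (check_cert_frankl (e := [:: Some a; Some b]) (w := [:: 1; 1])
  (Q := [:: bits 2 3]) (L := [:: (2, bits 2 0, bits 2 3, bits 2 3)])) => //.
  by apply/set0Pn; exists [set a; b].
move=> q; rewrite inE => /eqP->; exists [set a; b] => //; split.
  by rewrite subUset !sub1set !inE !eqxx orbT.
by rewrite /= !inE !eqxx orbT.
Qed.

Lemma FC_three_triples (T : finType) (Fc : {set {set T}}) :
    2 < #|Fc| -> (forall A, A \in Fc -> #|A| = 3) -> #|cover Fc| <= 5 ->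
  FC_family Fc.
Proof.
move=> Fc_gt2 Fc3 leX5; have leX7 : #|cover Fc| <= 7 by apply: leq_trans leX5 _.
have Fc0 : Fc != set0 by rewrite -card_gt0 (ltn_trans _ Fc_gt2).
have [Q + plQ] := placed3 Fc_gt2 Fc3 leX7.
rewrite mem_cat => /orP[QR|].
  exact: placed_certs Fc0 leX7 check_certs3 QR plQ.
(* The other representatives span at least six points, too many for [cover Fc]. *)
have big_ok :
    all (fun Q => 5 < count id (foldr bor (nseq 7 false) Q)) reps3big.
  by lazy.
move/(allP big_ok); rewrite ltnNge => /negP[].
exact: leq_trans (placed_card_cover leX7 plQ) leX5.
Qed.

(** Three of the members either already have a certificate or form a copy of a family in [reps3big];
    in the latter case a fourth member leads to a certified family. *)
Lemma FC_four_triples (T : finType) (Fc : {set {set T}}) :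
    3 < #|Fc| -> (forall A, A \in Fc -> #|A| = 3) -> #|cover Fc| <= 7 ->
  FC_family Fc.
Proof.
move=> Fc_gt3 Fc3 leX7.
have Fc0 : Fc != set0 by rewrite -card_gt0 (ltn_trans _ Fc_gt3).
have [Q + plQ] := placed3 (ltnW Fc_gt3) Fc3 leX7.
rewrite mem_cat => /orP[QR|QR].
  exact: placed_certs Fc0 leX7 check_certs3 QR plQ.
have [||Q' + plQ'] :=
  placed_extends Fc3 leX7 _ _ extends4 (ex_intro2 _ _ Q QR plQ).
- by rewrite /= !Fc_gt3.
- by lazy.
rewrite mem_cat => /orP[Q'R|Q'R].
  exact: placed_certs Fc0 leX7 check_certs3 Q'R plQ'.
exact: placed_certs Fc0 leX7 check_certs4 Q'R plQ'.
Qed.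

Theorem theorem3 :
  (forall (T : finType) (a : T), FC_family [set [set a]]) /\
  (forall (T : finType) (a b : T), a != b -> FC_family [set [set a; b]]) /\
  (forall (T : finType) (Fc : {set {set T}}),
      #|Fc| = 3 -> (forall A, A \in Fc -> #|A| = 3) -> #|cover Fc| <= 5 ->
      FC_family Fc) /\
  (forall (T : finType) (Fc : {set {set T}}),
      #|Fc| = 4 -> (forall A, A \in Fc -> #|A| = 3) -> #|cover Fc| <= 6 ->
      FC_family Fc) /\
  (forall (T : finType) (Fc : {set {set T}}),
      #|Fc| = 4 -> (forall A, A \in Fc -> #|A| = 3) -> #|cover Fc| <= 7 ->
      FC_family Fc).
Proof.
split=> [T a|]; first by rewrite -(setUid [set a]); apply: FC_pair.
split=> [T a b _|]; first exact: FC_pair.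
split=> [T Fc Fc3|]; first by apply: FC_three_triples; rewrite Fc3.
split=> T Fc Fc4 FcT leX; apply: FC_four_triples; rewrite ?Fc4 //.
exact: leq_trans leX _.
Qed.
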